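(* Every cyclotomic model set (with underlying $\mathbb{Z}$-module $\mathbb{Z}[\zeta_n]$, for some $n\ge 3$) is an algebraic Delone set.
   Context: Identify $\mathbb{R}^2$ with $\mathbb{C}$; $\zeta_n:=e^{2\pi i/n}$; $\phi$ is Euler's totient function. A Delone set in $\mathbb{R}^2$ is a subset that is uniformly discrete (there is $r>0$ such that every open ball of radius $r$ contains at most one of its points) and relatively dense (there is $R>0$ such that every open ball of radius $R$ contains at least one of its points). For $\Lambda\subset\mathbb{C}$, let $\mathbb{K}_{\Lambda}:=\mathbb{Q}\big((\Lambda-\Lambda)\cup\overline{(\Lambda-\Lambda)}\big)$ (bar = complex conjugation). A homothety of $\mathbb{R}^2$ is a map $z\mapsto\lambda z+t$ with $\lambda>0$ real and $t\in\mathbb{R}^2$. A Delone set $\Lambda\subset\mathbb{R}^2$ is an algebraic Delone set if (Alg) $[\mathbb{K}_{\Lambda}:\mathbb{Q}]<\infty$, and (Hom) for every finite subset $F$ of $\mathbb{K}_{\Lambda}$ there is a homothety $h$ of $\mathbb{R}^2$ with $h(F)\subset\Lambda$. Cyclotomic model sets: let $n\ge 3$. A star map is any map $.^{\star}:\mathbb{Z}[\zeta_n]\to(\mathbb{R}^2)^{\phi(n)/2-1}$ of the form $z\mapsto(\sigma_2(z),\dots,\sigma_{\phi(n)/2}(z))$, where $\{\sigma_2,\dots,\sigma_{\phi(n)/2}\}$ arises from $\operatorname{Gal}(\mathbb{Q}(\zeta_n)/\mathbb{Q})\setminus\{\mathrm{id},\bar{\cdot}\}$ by choosing exactly one automorphism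 from each pair of complex conjugate ones. For $\phi(n)=2$ (i.e. $n\in\{3,4,6\}$), $(\mathbb{R}^2)^{\phi(n)/2-1}$ is the trivial group $\{0\}$ and the star map is the zero map. A cyclotomic model set with underlying $\mathbb{Z}$-module $\mathbb{Z}[\zeta_n]$ is any translate (in $\mathbb{R}^2$) of a set $\Lambda(W):=\{z\in\mathbb{Z}[\zeta_n]: z^{\star}\in W\}$, where $.^{\star}$ is such a star map and $W\subset(\mathbb{R}^2)^{\phi(n)/2-1}$ satisfies $\varnothing\ne\operatorname{int}W\subset W\subset\operatorname{cl}(\operatorname{int}W)$ with $\operatorname{cl}(\operatorname{int}W)$ compact. *)

(* Defs.v *)
From HB Require Import structures.
From mathcomp Require Import all_boot all_order all_algebra.
From mathcomp Require Import complex.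
From mathcomp Require Import all_classical all_reals all_analysis.

Set Implicit Arguments.
Unset Strict Implicit.
Unset Printing Implicit Defensive.

Import Order.TTheory GRing.Theory Num.Theory.
Import numFieldNormedType.Exports.

Local Open Scope classical_set_scope.
Local Open Scope ring_scope.

(* R[i] packed as a numClosedFieldType, so that the topology which
   MathComp-Analysis puts on every numFieldType (the one of the modulus) is
   inferred; the plain type R[i] carries no topology.  Under the identification
   of R^2 with C, the modulus is the Euclidean norm of R^2. *)
Definition Cplx (R : realType) : numClosedFieldType := R[i]%C.

Section Delone.
Variable R : realType.
Local Notation C := (Cplx R).

Definition open_disc (c : C) (r : R) : set C := [set z | `|z - c| < r%:C%C].

Definition uniformly_discrete (L : set C) :=
  exists2 r : R, 0 < r &
    forall c, is_subset1 (L `&` open_disc c r).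

Definition relatively_dense (L : set C) :=
  exists2 R0 : R, 0 < R0 & forall c, (L `&` open_disc c R0) !=set0.

Definition Delone (L : set C) := uniformly_discrete L /\ relatively_dense L.

Definition homothety (lambda : R) (t : C) (z : C) : C := lambda%:C%C * z + t.

(* C has characteristic 0, so a subfield automatically contains Q. *)
Definition is_subfield (K : set C) := divring_closed (mem K).

Definition gen_field (G : set C) : set C := smallest is_subfield G.

(* [K : Q] is finite: K is spanned over Q by finitely many of its elements. *)
Definition finite_over_Q (K : set C) :=
  exists (m : nat) (b : 'I_m -> C), (forall i, K (b i)) /\
    forall z, K z -> exists q : 'I_m -> rat, z = \sum_(i < m) ratr (q i) * b i.

Definition differences (L : set C) : set C := [set x - y | x in L & y in L].

Definition KL (L : set C) : set C :=
  gen_field (differences L `|` [set z^* | z in differences L]).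

Definition algebraic_Delone (L : set C) :=
  [/\ Delone L,
      finite_over_Q (KL L) &
      forall F : set C, finite_set F -> F `<=` KL L ->
        exists lambda t, 0 < lambda /\ homothety lambda t @` F `<=` L].

End Delone.

Section CyclotomicModelSets.
Variables (R : realType) (n : nat).
Local Notation C := (Cplx R).

Definition zeta : C := (cos (2 * pi / n%:R) +i* sin (2 * pi / n%:R))%C.

Definition Zzeta : set C := [set z | exists p : {poly int}, z = (map_poly intr p).[zeta]].

Definition Qzeta : set C := gen_field [set zeta].

(* Gal(Q(zeta_n)/Q), an automorphism of the subset Qzeta of C being represented
   by any map C -> C that restricts to it: only values on Qzeta matter, and two
   representatives are compared with eq_on_Qzeta. *)
Definition Gal (s : C -> C) :=
  [/\ set_bij Qzeta Qzeta s,
      {in Qzeta &, {morph s : x y / x + y}},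
      {in Qzeta &, {morph s : x y / x * y}} &
      forall q : rat, s (ratr q) = ratr q].

Definition eq_on_Qzeta (s t : C -> C) := {in Qzeta, s =1 t}.

Definition conjugate_aut (s : C -> C) : C -> C := fun z => (s z)^*.

Definition star_dim : nat := ((totient n)./2).-1.

(* (R^2)^(phi(n)/2 - 1), with the product topology. *)
Definition internal_space := 'rV[C]_star_dim.

(* The family sigma_2, ..., sigma_(phi(n)/2), indexed from 0: it consists of
   automorphisms other than id and complex conjugation, and for each such
   automorphism t exactly one index i has sigma_i equal to t or to its complex
   conjugate. *)
Definition star_family (s : 'I_star_dim -> C -> C) :=
  (forall i, [/\ Gal (s i), ~ eq_on_Qzeta (s i) id &
                 ~ eq_on_Qzeta (s i) (fun z => z^*)]) /\
  forall t, Gal t -> ~ eq_on_Qzeta t id -> ~ eq_on_Qzeta t (fun z => z^*) ->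
    exists! i, eq_on_Qzeta (s i) t \/ eq_on_Qzeta (s i) (conjugate_aut t).

Definition star_map (s : 'I_star_dim -> C -> C) (z : C) : internal_space :=
  \row_i s i z.

Definition is_window (W : set internal_space) :=
  [/\ W° !=set0, W° `<=` W, W `<=` closure W° & compact (closure W°)].

Definition model_set (s : 'I_star_dim -> C -> C) (W : set internal_space) : set C :=
  [set z | Zzeta z /\ W (star_map s z)].

Definition cyclotomic_model_set (L : set C) :=
  exists s W (t : C), [/\ star_family s, is_window W &
    L = [set z + t | z in model_set s W]].

End CyclotomicModelSets.

(* Main.v *)
Require Import Defs.
From HB Require Import structures.
From mathcomp Require Import all_boot all_order all_algebra.
From mathcomp Require Import finmap algC cyclotomic complex ring lra.
From mathcomp Require Import all_classical all_reals all_analysis.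

(** Write x_0 = zeta and x_i = sigma_i(zeta): these primitive n-th roots of unity
    together with their complex conjugates are pairwise distinct and exhaust all
    primitive n-th roots of unity.

    Uniform discreteness: the norm of a nonzero element p(zeta) of Z[zeta] is a
    nonzero integer, so p(zeta) cannot be small while all p(x_i) are bounded.

    Approximation: interpolating at the x_i by real polynomials and rounding the
    coefficients, every family (y_i) is within a fixed distance D of some
    (p(x_i)) with p integral.  Hence infinitely many p have p(x_i) bounded for
    i > 0, and the pigeonhole principle produces e in Z[zeta], e <> 0, whose
    conjugates e(x_i), i > 0, are as small as desired.  Approximating y_i / e(x_i)
    and multiplying by e shows that z in Z[zeta] can be found at bounded distance
    from any point with z^star arbitrarily close to any point of internal space:
    this is relative density.

    (Hom): if q F lies in Z[zeta], then for e as above q^2 |e|^2 F + z has its star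
    image in the window, and the factor q^2 |e|^2 is real and positive.  Applied to
    F = {0, 1, zeta}, this shows that K_L = Q(zeta), which is finite over Q. *)

Set Implicit Arguments.
Unset Strict Implicit.
Unset Printing Implicit Defensive.

Import Order.TTheory GRing.Theory Num.Theory.
Import numFieldNormedType.Exports.
Local Open Scope classical_set_scope.
Local Open Scope ring_scope.

Local Notation evZ p x := (map_poly intr p).[x].
Local Notation evQ p x := (map_poly ratr p).[x].

(** * Cyclotomic polynomials, conjugates and norms of cyclotomic integers *)

Section CyclotomicIntegers.
Variables (F : numFieldType) (n : nat).

Lemma evZ_evQ (p : {poly int}) (x : F) : evZ p x = evQ (map_poly intr p) x.
Proof.
by rewrite -map_poly_comp; congr (_.[x]); apply: eq_map_poly => a /=; rewrite rmorph_int.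
Qed.

(** Since X^n - 1 is the product of the ['Phi_d] with d dividing n, z is a root of one of them; then
    z^d = 1, which forces d = n. *)
Lemma root_Cyclotomic (z : F) : n.-primitive_root z -> root (map_poly intr 'Phi_n) z.
Proof.
move=> prim_z; have n_gt0 := prim_order_gt0 prim_z.
have: root (map_poly intr (\prod_(d <- divisors n) 'Phi_d)) z.
  rewrite prod_Cyclotomic // rmorphB /= map_polyXn rmorph1 rootE !hornerE.
  by rewrite (prim_expr_order prim_z) subrr.
rewrite rmorph_prod /=.
have [_ _ inD] := divisors_correct n_gt0.
rewrite rootE horner_prod prodf_seq_eq0 => /hasP[d].
rewrite inD => d_dvd /= zd.
suff <- : d = n by [].
have d_gt0 := dvdn_gt0 n_gt0 d_dvd.
apply/eqP; rewrite eqn_dvd d_dvd (prim_order_dvd prim_z) -subr_eq0.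
have -> : z ^+ d - 1 = evZ ('X^d - 1) z.
  by rewrite rmorphB /= map_polyXn rmorph1 !hornerE.
rewrite -prod_Cyclotomic // rmorph_prod horner_prod /=.
have [_ _ inDd] := divisors_correct d_gt0.
rewrite prodf_seq_eq0; apply/hasP; exists d => //.
by rewrite inDd.
Qed.

(* Any root in algC of a factor of 'Phi_n has 'Phi_n as minimal polynomial. *)
Lemma Cyclotomic_irreducible : (0 < n)%N ->
  irreducible_poly (map_poly intr 'Phi_n : {poly rat}).
Proof.
move=> n_gt0; set P := map_poly _ _.
have szP : size P = (totient n).+1.
  by rewrite size_map_inj_poly ?size_Cyclotomic //; apply: intr_inj.
split=> [|q sz_q dv_q]; first by rewrite szP ltnS totient_gt0.
rewrite /eqp dv_q /=.
have /closed_rootP[w qw] : size (map_poly (@ratr algC) q) != 1 by rewrite size_map_poly.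
have [z0 prim_z0] := C_prim_root_exists n_gt0.
have prim_w : n.-primitive_root w.
  rewrite -(root_cyclotomic prim_z0) -(Cintr_Cyclotomic prim_z0).
  have -> : map_poly intr 'Phi_n = map_poly (@ratr algC) P.
    by rewrite -map_poly_comp; apply: eq_map_poly => a /=; rewrite rmorph_int.
  by case/dvdpP: dv_q => r ->; rewrite rmorphM rootM qw orbT.
have [r [Dr _] dv_r] := minCpolyP w.
suff <- : r = P by rewrite -dv_r.
apply: (map_inj_poly (fmorph_inj (@ratr algC))); rewrite ?rmorph0 // -Dr.
rewrite (minCpoly_cyclotomic prim_w) -(Cintr_Cyclotomic prim_w) -map_poly_comp.
by apply: eq_map_poly => a /=; rewrite rmorph_int.
Qed.

Lemma Cyclotomic_coprimep_or_dvdp (p : {poly rat}) : (0 < n)%N ->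
  coprimep (map_poly intr 'Phi_n) p \/ map_poly intr 'Phi_n %| p.
Proof.
move=> n_gt0; have [_ irr] := Cyclotomic_irreducible n_gt0.
have [cop|ncop] := boolP (coprimep (map_poly intr 'Phi_n) p); [by left | right].
have /andP[_ dv] := irr _ ncop (dvdp_gcdl _ _).
exact: dvdp_trans dv (dvdp_gcdr _ _).
Qed.

Lemma evQ_Cyclotomic (z : F) : n.-primitive_root z ->
  evQ (map_poly intr 'Phi_n) z = 0.
Proof. by move=> prim_z; rewrite -evZ_evQ; apply/rootP/root_Cyclotomic. Qed.

(** A Bezout relation u ['Phi_n] + v p = 1, evaluated at z, exhibits v(z) as the inverse. *)
Lemma evQ_inv (z : F) (p : {poly rat}) : n.-primitive_root z -> evQ p z != 0 ->
  exists q : {poly rat}, (evQ p z)^-1 = evQ q z.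
Proof.
move=> prim_z pz; have Pz := evQ_Cyclotomic prim_z.
have [cop|/dvdpP[r Dp]] := Cyclotomic_coprimep_or_dvdp p (prim_order_gt0 prim_z).
  have [[u v] /= uv1] := Bezout_eq1_coprimepP _ _ cop.
  exists v; apply: (mulIf pz); rewrite mulVf // -hornerM -rmorphM.
  move/(congr1 (fun q => evQ q z)): uv1.
  by rewrite rmorphD rmorph1 hornerD hornerC !rmorphM /= !hornerM Pz mulr0 add0r => ->.
by move: pz; rewrite Dp rmorphM /= hornerM Pz mulr0 eqxx.
Qed.

Lemma Cyclotomic_dvdp (z : F) (p : {poly rat}) :
  n.-primitive_root z -> evQ p z = 0 -> map_poly intr 'Phi_n %| p.
Proof.
move=> prim_z pz.
have [cop|//] := Cyclotomic_coprimep_or_dvdp p (prim_order_gt0 prim_z).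
have /(coprimep_root (p := map_poly ratr (map_poly intr 'Phi_n))) :
  coprimep (map_poly ratr (map_poly intr 'Phi_n)) (map_poly (@ratr F) p).
  by rewrite coprimep_map.
by move=> /(_ z); rewrite rootE evQ_Cyclotomic // eqxx pz eqxx => /(_ isT).
Qed.

(** Rational polynomial relations pass from one primitive root to another because ['Phi_n] divides
    every polynomial vanishing at one of them. This carries the Galois theory of the proof. *)
Lemma conjugate_root (z w : F) (p : {poly rat}) :
  n.-primitive_root z -> n.-primitive_root w -> evQ p z = 0 -> evQ p w = 0.
Proof.
move=> prim_z prim_w pz0; have /dvdpP[q ->] := Cyclotomic_dvdp prim_z pz0.
by rewrite rmorphM /= hornerM evQ_Cyclotomic // mulr0.
Qed.

(** The set of elements does not depend on z, only their order does. Listing them as powers of z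
    makes a product of values p(x) over the list the value at z of one integral polynomial. *)
Definition prim_roots (z : F) : seq F :=
  [seq z ^+ i | i <- iota 0 n & coprime i n].

Lemma mem_prim_roots (z x : F) : n.-primitive_root z ->
  (x \in prim_roots z) = n.-primitive_root x.
Proof.
move=> prim_z; have n_gt0 := prim_order_gt0 prim_z.
apply/mapP/idP=> [[k]|prim_x].
  by rewrite mem_filter => /andP[co_k _] ->; rewrite prim_root_exp_coprime.
have [k Dx] := prim_rootP prim_z (prim_expr_order prim_x).
exists (k %% n)%N; last by rewrite prim_expr_mod.
rewrite mem_filter mem_iota /= ltn_mod n_gt0 coprime_modl andbT.
by rewrite -(prim_root_exp_coprime k prim_z) -Dx.
Qed.

Lemma uniq_prim_roots (z : F) : n.-primitive_root z -> uniq (prim_roots z).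
Proof.
move=> prim_z; rewrite map_inj_in_uniq ?filter_uniq ?iota_uniq // => i j.
rewrite !mem_filter !mem_iota /= => /andP[_ lti] /andP[_ ltj] /eqP.
by rewrite (eq_prim_root_expr prim_z) !modn_small // => /eqP.
Qed.

Lemma size_prim_roots (z : F) : size (prim_roots z) = totient n.
Proof.
rewrite size_map size_filter totient_count_coprime -sum1_count.
rewrite /index_iota subn0 -[in RHS]big_mkcond /=.
by apply: eq_bigl => i; rewrite coprime_sym.
Qed.

(* The product of the p(x^i) over i coprime to n takes the same value N at all
   primitive roots x; its remainder modulo 'Phi_n has degree less than the number of
   these roots, hence is the constant N, which is therefore an integer. *)
Lemma norm_int (z : F) (p : {poly int}) : n.-primitive_root z ->
  exists a : int, \prod_(x <- prim_roots z) evZ p x = a%:~R.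
Proof.
move=> prim_z; set N := \prod_(x <- _) _.
pose P : {poly int} := \prod_(i <- iota 0 n | coprime i n) (p \Po 'X^i).
have evP x : n.-primitive_root x -> evZ P x = N.
  move=> prim_x; transitivity (\prod_(y <- prim_roots x) evZ p y).
    rewrite /prim_roots big_map big_filter rmorph_prod horner_prod.
    apply: eq_bigr => i _ /=.
    by rewrite map_comp_poly /= map_polyXn horner_comp hornerXn.
  apply: perm_big; apply: uniq_perm; rewrite ?uniq_prim_roots // => y.
  by rewrite !mem_prim_roots.
have mon := Cyclotomic_monic n.
pose r := Pdiv.Ring.rmodp P 'Phi_n.
have evr x : n.-primitive_root x -> evZ r x = N.
  move=> prim_x; rewrite -(evP x prim_x) [in RHS](Pdiv.RingMonic.rdivp_eq mon P).
  rewrite rmorphD rmorphM /= hornerD hornerM.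
  by rewrite (rootP (root_Cyclotomic prim_x)) mulr0 add0r.
have sz_r : (size r <= totient n)%N.
  by rewrite -ltnS -size_Cyclotomic Pdiv.Ring.ltn_rmodpN0 ?monic_neq0.
have tot_gt0 : (0 < totient n)%N by rewrite totient_gt0 (prim_order_gt0 prim_z).
suff : map_poly intr r - N%:P = 0 :> {poly F}.
  move/(congr1 (fun q : {poly F} => q`_0)) => /eqP.
  rewrite coefB coef_map coefC eqxx coef0 subr_eq0 /= => /eqP <-.
  by exists r`_0.
apply: (roots_geq_poly_eq0 (rs := prim_roots z)).
- apply/allP => x; rewrite mem_prim_roots // => prim_x.
  by rewrite rootE hornerD hornerN hornerC evr // subrr.
- exact: uniq_prim_roots.
rewrite size_prim_roots; apply: leq_trans (size_polyD _ _) _.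
rewrite geq_max size_polyN (leq_trans (size_poly _ _)) //=.
by rewrite (leq_trans (size_polyC_leq1 _)).
Qed.

(** The product of the conjugates is an integer, and it is nonzero: if one conjugate vanished, all
    would. *)
Lemma norm_ge1 (z : F) (p : {poly int}) : n.-primitive_root z -> evZ p z != 0 ->
  1 <= \prod_(x <- prim_roots z) `|evZ p x|.
Proof.
move=> prim_z pz; have [a Da] := norm_int p prim_z.
rewrite -normr_prod Da -intr_norm -[1]/(1%:~R) ler_int -gtz0_ge1 normr_gt0.
rewrite -(intr_eq0 F) -Da prodf_seq_neq0; apply/allP => x.
rewrite mem_prim_roots // => prim_x /=; apply: contra pz => /eqP.
by rewrite !evZ_evQ => px; apply/eqP/(conjugate_root prim_x prim_z).
Qed.

End CyclotomicIntegers.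

(** * Complex conjugation on roots of unity *)

Section RootsOfUnity.
Variables (F : numClosedFieldType) (n : nat).

Lemma prim_root_norm1 (x : F) : n.-primitive_root x -> `|x| = 1.
Proof.
move=> prim_x; apply/eqP; rewrite -(@pexpr_eq1 _ _ n) ?normr_ge0 //.
  by rewrite -normrX (prim_expr_order prim_x) normr1.
exact: prim_order_gt0 prim_x.
Qed.

(** Conjugation thus becomes the substitution of X^(n-1) for X, which keeps coefficients
    integral. *)
Lemma prim_root_conj (x : F) : n.-primitive_root x -> x^* = x ^+ n.-1.
Proof.
move=> prim_x; have x1 := prim_root_norm1 prim_x.
have x0 : x != 0 by rewrite -normr_eq0 x1 oner_eq0.
apply: (mulfI x0); rewrite -exprS prednK ?(prim_order_gt0 prim_x) //.
by rewrite (prim_expr_order prim_x) -normCK x1 expr1n.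
Qed.

Lemma prim_root_nreal (x : F) : (2 < n)%N -> n.-primitive_root x -> x != x^*.
Proof.
move=> n_gt2 prim_x; apply/eqP => xx.
have : x ^+ 2 = 1 by rewrite expr2 {2}xx -normCK (prim_root_norm1 prim_x) expr1n.
move/eqP; rewrite -(prim_order_dvd prim_x) => /dvdn_leq dv.
by have := leq_trans n_gt2 (dv isT).
Qed.

Lemma evZ_conj (p : {poly int}) (x : F) : evZ p x^* = (evZ p x)^*.
Proof.
rewrite -horner_map -map_poly_comp; congr (_.[_]).
by apply: eq_map_poly => a /=; rewrite rmorph_int.
Qed.

Lemma evQ_conj (p : {poly rat}) (x : F) : evQ p x^* = (evQ p x)^*.
Proof.
rewrite -horner_map -map_poly_comp; congr (_.[_]).
by apply: eq_map_poly => a /=; rewrite fmorph_rat.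
Qed.

End RootsOfUnity.

Lemma evZ_bounded (F : numDomainType) (p : {poly int}) :
  exists M : nat, forall y : F, `|y| = 1 -> `|evZ p y| <= M%:R.
Proof.
exists (\sum_(k < size p) absz (p`_k)%R)%N => y y1.
rewrite (@horner_coef_wide _ (size p)); last exact: size_poly.
rewrite (le_trans (ler_norm_sum _ _ _)) // natr_sum ler_sum // => k _.
by rewrite normrM normrX y1 expr1n mulr1 coef_map /= -intr_norm -abszE.
Qed.

(** * The field Q(zeta) and its automorphisms *)

Section Zeta.
Variables (R : realType) (n : nat).
Local Notation C := (Cplx R).
Local Notation z := (zeta R n).

Lemma zetaX k : z ^+ k = (cos (k%:R * (2 * pi / n%:R)) +i* sin (k%:R * (2 * pi / n%:R)))%C.
Proof.
elim: k => [|k IH]; first by rewrite mul0r cos0 sin0.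
rewrite exprS IH -[k.+1%:R]natr1 /zeta; set t := 2 * pi / n%:R.
rewrite mulrDl mul1r cosD sinD.
apply/eqP; rewrite eq_complex /=; apply/andP; split; apply/eqP; ring.
Qed.

Lemma zeta_prim : (0 < n)%N -> n.-primitive_root z.
Proof.
move=> n_gt0; rewrite /primitive_root_of_unity n_gt0; apply/forallP => -[i lt_i] /=.
have n0 : n%:R != 0 :> R by rewrite pnatr_eq0 -lt0n.
rewrite unity_rootE zetaX; have [-> | ne] := eqVneq i.+1 n.
  by rewrite mulrC divfK // mulr_natl cos2pi sin2pi !eqxx.
rewrite eqbF_neg; apply/negP => /eqP[c1 _].
(* The half angle h lies strictly between 0 and pi, so sin h > 0 and cos (2h) = 1 - 2 sin^2 h <
   1. *)
pose h : R := i.+1%:R * (pi / n%:R).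
have h0 : 0 < sin h.
  apply: sin_gt0_pi; apply/andP; split.
    by rewrite /h mulr_gt0 ?ltr0n // divr_gt0 ?pi_gt0 ?ltr0n.
  rewrite /h mulrCA gtr_pMr ?pi_gt0 // ltr_pdivrMr ?ltr0n // mul1r ltr_nat.
  by rewrite ltn_neqAle ne.
move: c1; have -> : i.+1%:R * (2 * pi / n%:R) = h *+ 2 by rewrite /h -mulr_natl; ring.
rewrite cos_mulr2n cos2sin2 => c1.
have s2 : 0 < sin h ^+ 2 by rewrite exprn_gt0.
move: c1 s2; set u := sin h ^+ 2; lra.
Qed.

(** The values at zeta of rational polynomials form a field by [evQ_inv]; conversely, every subfield
    containing zeta contains them. *)
Lemma QzetaP x : (0 < n)%N -> Qzeta n x <-> exists p : {poly rat}, x = evQ p z.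
Proof.
move=> n_gt0; have prim_z := zeta_prim n_gt0; split=> [Qx|[p ->]].
  pose K : set C := [set x | exists p : {poly rat}, x = evQ p z].
  apply: (Qx K); split=> [|_ ->]; last first.
    by exists 'X; rewrite map_polyX hornerX.
  split=> [|u v|u v]; rewrite ?inE.
  - by exists 1; rewrite rmorph1 hornerC.
  - by move=> [p ->] [q ->]; exists (p - q); rewrite rmorphB hornerD hornerN.
  move=> [p ->] [q ->].
  have [q0|qN0] := eqVneq (evQ q z) 0.
    by exists 0; rewrite rmorph0 horner0 q0 invr0 mulr0.
  have [r ->] := evQ_inv prim_z qN0.
  by exists (p * r); rewrite rmorphM /= hornerM.
move=> K [[K1 KB KV] Kz].
have K0 : 0 \in mem K by rewrite -(subrr 1) KB.
have KN u : u \in mem K -> - u \in mem K.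
  by move=> Ku; rewrite -sub0r KB.
have KD u v : u \in mem K -> v \in mem K -> u + v \in mem K.
  by move=> Ku Kv; rewrite -[v]opprK KB // KN.
have KM u v : u \in mem K -> v \in mem K -> u * v \in mem K.
  by move=> Ku Kv; rewrite -[v]invrK KV // -[v^-1]mul1r KV.
have Knat m : m%:R \in mem K.
  by elim: m => [|m IH]; rewrite -?natr1 ?KD.
have Kint (m : int) : m%:~R \in mem K.
  by case: m => m; rewrite ?NegzE ?rmorphN ?KN ?Knat.
have Kz' : z \in mem K by rewrite inE; apply: Kz.
suff : evQ p z \in mem K by rewrite inE.
elim/poly_ind: p => [|p q IH]; first by rewrite rmorph0 horner0 (Knat 0).
rewrite rmorphD rmorphM /= map_polyX map_polyC !hornerE KD ?KM //.
by rewrite -[_^-1]mul1r KV.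
Qed.

Lemma evQ_Qzeta (p : {poly rat}) : (0 < n)%N -> evQ p z \in Qzeta n.
Proof. by move=> n_gt0; apply: mem_set; apply/QzetaP => //; exists p. Qed.

Lemma zeta_Qzeta : (0 < n)%N -> z \in Qzeta n.
Proof. by move=> /(evQ_Qzeta 'X); rewrite map_polyX hornerX. Qed.

Lemma Gal_horner (s : C -> C) (p : {poly rat}) : (0 < n)%N -> Gal n s ->
  s (evQ p z) = evQ p (s z).
Proof.
move=> n_gt0 [_ sD sM sQ].
have Qz := zeta_Qzeta n_gt0; have Qev q := evQ_Qzeta q n_gt0.
elim/poly_ind: p => [|p q IH].
  by rewrite !rmorph0 !horner0; have := sQ 0; rewrite rmorph0.
rewrite !rmorphD !rmorphM /= !map_polyX !map_polyC !hornerD !hornerMX !hornerC.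
have Qq : ratr q \in @Qzeta R n by have := Qev q%:P; rewrite map_polyC hornerC.
rewrite sD ?(sM (evQ p z) z) ?IH ?[s (_ q)]sQ //.
by have := Qev (p * 'X); rewrite rmorphM /= map_polyX hornerMX.
Qed.

Lemma Gal_prim_root (s : C -> C) : (0 < n)%N -> Gal n s -> n.-primitive_root (s z).
Proof.
move=> n_gt0 Gs; have [[_ sI _] _ _ sQ] := Gs.
rewrite /primitive_root_of_unity n_gt0; apply/forallP => i.
have := zeta_prim n_gt0; rewrite /primitive_root_of_unity => /andP[_ /forallP/(_ i)].
rewrite !unity_rootE => /eqP <-.
have evX (x : C) : x ^+ i.+1 = evQ 'X^(i.+1) x by rewrite map_polyXn hornerXn.
have s1 : s 1 = 1 by have := sQ 1; rewrite rmorph1.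
have Q1 : 1 \in @Qzeta R n by have := evQ_Qzeta 1 n_gt0; rewrite rmorph1 hornerC.
rewrite evX -Gal_horner // -evX.
apply/eqP; apply/idP/idP => /eqP szk; apply/eqP; last by rewrite szk.
by apply: sI; rewrite ?s1 // evX evQ_Qzeta.
Qed.

(** Assuming only compatibility with evaluation, rather than [Gal], lets this apply directly to the
    identity, to conjugation and to [conjugate_aut]. *)
Lemma eq_on_QzetaP (s t : C -> C) : (0 < n)%N ->
  (forall p, s (evQ p z) = evQ p (s z)) -> (forall p, t (evQ p z) = evQ p (t z)) ->
  s z = t z -> eq_on_Qzeta n s t.
Proof. by move=> n_gt0 hs ht st x /set_mem/(QzetaP _ n_gt0)[p ->]; rewrite hs ht st. Qed.

(** Sending p(zeta) to p(w) is well defined and injective by [conjugate_root], and onto because zeta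
    is a power of w. *)
Lemma Gal_exists (w : C) : n.-primitive_root w -> exists t, Gal n t /\ t z = w.
Proof.
move=> prim_w; have n_gt0 := prim_order_gt0 prim_w; have prim_z := zeta_prim n_gt0.
(* By [transfer] the chosen p is immaterial; 0 is a default value outside Q(zeta). *)
pose t x := if pselect (exists p : {poly rat}, x = evQ p z) is left h
            then evQ (projT1 (cid h)) w else 0.
have transfer (x y : C) p q : n.-primitive_root x -> n.-primitive_root y ->
    evQ p x = evQ q x -> evQ p y = evQ q y.
  move=> prim_x prim_y pq; apply/eqP; rewrite -subr_eq0 -hornerN -hornerD -rmorphB.
  by apply/eqP/(conjugate_root prim_x) => //; rewrite rmorphB hornerD hornerN pq subrr.
have tE p : t (evQ p z) = evQ p w.
  rewrite /t; case: pselect => [h|]; last by case; exists p.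
  by case: (cid h) => q /= Dq; apply: transfer prim_z prim_w _.
have QE x : x \in Qzeta n -> exists p : {poly rat}, x = evQ p z.
  by move=> /set_mem/(QzetaP _ n_gt0).
have tz : t z = w by have := tE 'X; rewrite !map_polyX !hornerX.
exists t; split=> //; split.
- split.
  + move=> x /mem_set/QE[p ->]; rewrite tE.
    have [k ->] := prim_rootP prim_z (prim_expr_order prim_w).
    have -> : evQ p (z ^+ k) = evQ (p \Po 'X^k) z.
      by rewrite map_comp_poly /= map_polyXn horner_comp hornerXn.
    exact/set_mem/evQ_Qzeta.
  + move=> x y /QE[p ->] /QE[q ->]; rewrite !tE => pq.
    exact: transfer prim_w prim_z pq.
  + move=> y /mem_set/QE[p ->].
    have [k Dz] := prim_rootP prim_w (prim_expr_order prim_z).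
    exists (evQ (p \Po 'X^k) z); first by apply/set_mem/evQ_Qzeta.
    by rewrite tE map_comp_poly /= map_polyXn horner_comp hornerXn -Dz.
- by move=> x y /QE[p ->] /QE[q ->]; rewrite -hornerD -rmorphD !tE rmorphD hornerD.
- by move=> x y /QE[p ->] /QE[q ->]; rewrite -hornerM -rmorphM !tE rmorphM hornerM.
by move=> q; have := tE q%:P; rewrite !map_polyC !hornerC.
Qed.

(** The bound [M] holds on the whole unit circle, hence at every conjugate of the numerators at
    once. *)
Lemma common_denominator (l : seq C) : (0 < n)%N ->
  (forall x, x \in l -> Qzeta n x) ->
  exists (q : int) (M : nat), q != 0 /\ forall x, x \in l -> exists p : {poly int},
    q%:~R * x = evZ p z /\ forall y : C, `|y| = 1 -> `|evZ p y| <= M%:R.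
Proof.
move=> n_gt0; elim: l => [|x l IH] Ql; first by exists 1, 0%N.
have [|q [M [q0 qP]]] := IH; first by move=> y yl; apply: Ql; rewrite inE yl orbT.
have /(QzetaP _ n_gt0)[p Dx] := Ql x (mem_head _ _).
have [P [a a0 Dp]] := rat_poly_scale p; have [M' PM] := evZ_bounded C P.
have ax : a%:~R * x = evZ P z.
  rewrite Dx Dp linearZ /= hornerZ -evZ_evQ fmorphV rmorph_int mulrA mulfV ?mul1r //.
  by rewrite intr_eq0.
(* The new numerator gets multiplied by q and the old ones by a; the sum dominates both rescaled
   bounds. *)
exists (a * q), (`|a| * M + `|q| * M')%N; split=> [|y]; first by rewrite mulf_neq0.
rewrite inE => /predU1P[-> | /qP[Q [qy QM]]].
  exists (q *: P); split=> [|u u1]; rewrite linearZ hornerZ /=.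
    by rewrite -ax rmorphM mulrCA mulrA.
  rewrite normrM -intr_norm -abszE natrD natrM ler_wpDl ?ler0n //.
  by rewrite natrM ler_wpM2l ?ler0n // PM.
exists (a *: Q); split=> [|u u1]; rewrite linearZ hornerZ /=.
  by rewrite -qy rmorphM mulrA.
rewrite normrM -intr_norm -abszE natrD natrM ler_wpDr ?ler0n //.
by rewrite ler_wpM2l ?ler0n // QM.
Qed.

End Zeta.

(** * The modulus of complex numbers: archimedean bounds, rounding and grids *)

Section Archimedean.
Variable R : realType.
Local Notation C := (Cplx R).

(* The embedding of R with codomain Cplx R, whose structures are convertible but
   not syntactically equal to those of R[i]. *)
Definition rC (a : R) : C := a%:C%C.

Fact rC_is_zmod_morphism : zmod_morphism rC.
Proof. exact: (rmorphB (real_complex R)). Qed.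
Fact rC_is_monoid_morphism : monoid_morphism rC.
Proof. by split; [exact: (rmorph1 (real_complex R))|exact: (rmorphM (real_complex R))]. Qed.
HB.instance Definition _ := GRing.isZmodMorphism.Build R C rC rC_is_zmod_morphism.
HB.instance Definition _ := GRing.isMonoidMorphism.Build R C rC rC_is_monoid_morphism.

Lemma rC_le (a b : R) : (rC a <= rC b) = (a <= b).
Proof. exact: lecR. Qed.

Lemma rC_lt (a b : R) : (rC a < rC b) = (a < b).
Proof. exact: ltcR. Qed.

Lemma rC_norm (a : R) : `|rC a| = rC `|a|.
Proof.
have [a0|a0] := leP 0 a; first by rewrite !ger0_norm // -(rmorph0 rC) rC_le.
by rewrite !ltr0_norm ?rmorphN // -(rmorph0 rC) rC_lt.
Qed.

Lemma norm_rC (x : C) : exists2 r : R, 0 <= r & `|x| = rC r.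
Proof.
by exists (Num.sqrt ((complex.Re x)^+2 + (complex.Im x)^+2)); [exact: sqrtr_ge0|exact: normc_def].
Qed.

Lemma Cplx_lt_nat (x : C) : exists m : nat, `|x| < m%:R.
Proof.
have [r _ ->] := norm_rC x; exists (Num.truncn r).+1.
by rewrite -(rmorph_nat rC) rC_lt truncnS_gt.
Qed.

Lemma Cplx_int_near (x : C) : x \is Num.real -> exists m : int, `|m%:~R - x| <= 1.
Proof.
move=> /complex_realP[k ->]; rewrite -/(rC k); exists (Num.floor k).
have /andP[le_fl lt_fl] := floor_itv k; rewrite rmorphD /= in lt_fl.
rewrite -(rmorph_int rC) -(rmorph1 rC) -rmorphB rC_norm rC_le ler_norml.
by apply/andP; split; lra.
Qed.

Lemma Re_Im_le (u : C) (B : nat) : `|u| <= B%:R ->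
  `|complex.Re u| <= B%:R /\ `|complex.Im u| <= B%:R.
Proof.
have -> : `|u| = rC (Num.sqrt ((complex.Re u)^+2 + (complex.Im u)^+2)) by exact: normc_def.
rewrite -(rmorph_nat rC) rC_le => le.
rewrite -!sqrtr_sqr; split; apply: le_trans le; apply: ler_wsqrtr.
  by rewrite lerDl sqr_ge0.
by rewrite lerDr sqr_ge0.
Qed.

Lemma normc_le_Re_Im (u : C) : `|u| <= rC (`|complex.Re u| + `|complex.Im u|).
Proof.
have -> : `|u| = rC (Num.sqrt ((complex.Re u)^+2 + (complex.Im u)^+2)) by exact: normc_def.
rewrite rC_le -[leRHS]ger0_norm ?addr_ge0 // -[leRHS]sqrtr_sqr; apply: ler_wsqrtr.
by rewrite sqrrD !real_normK ?num_real // lerD2r lerDl mulrn_wge0 ?mulr_ge0.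
Qed.

(** Here [f] numbers the cells of a grid of mesh 1/K with 2/K < d; real and imaginary parts within
    one cell differ by at most 1/K each. *)
Lemma box_cover (B : nat) (d : C) : 0 < d -> exists (M : nat) (f : C -> 'I_M * 'I_M),
  forall u v, `|u| <= B%:R -> `|v| <= B%:R -> f u = f v -> `|u - v| < d.
Proof.
move=> d_gt0; have [K] := Cplx_lt_nat (2 / d).
rewrite ger0_norm ?divr_ge0 ?ltW // ltr_pdivrMr // => ltK.
have K_gt0 : (0 < K)%N.
  by rewrite lt0n; apply: contraTneq ltK => ->; rewrite mul0r le_gtF ?ler0n.
(* For |a| <= B the truncated quantity lies between 0 and 2BK, both included. *)
pose g (a : R) : 'I_(2 * B * K).+1 := inord (Num.truncn ((a + B%:R) * K%:R)).
have gP (a b : R) : `|a| <= B%:R -> `|b| <= B%:R -> g a = g b -> `|a - b| * K%:R <= 1.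
  have tr_le (c : R) : `|c| <= B%:R -> 0 <= (c + B%:R) * K%:R /\
      (Num.truncn ((c + B%:R) * K%:R) < (2 * B * K).+1)%N.
    rewrite ler_norml => /andP[c1 c2].
    have c0 : 0 <= (c + B%:R) * K%:R by rewrite mulr_ge0 // -lerBlDr sub0r.
    split=> //; rewrite ltnS -(ler_nat R) (@le_trans _ _ ((c + B%:R) * K%:R)) ?truncn_le //.
    by rewrite !natrM ler_wpM2r // mulr_natl mulr2n lerD2r.
  move=> /tr_le[a0 a1] /tr_le[b0 b1] /(congr1 val); rewrite /g /= !inordK // => eq_tr.
  have := truncn_itv a0; have := truncn_itv b0; rewrite eq_tr.
  set t := Num.truncn _ => /andP[b2 b3] /andP[a2 a3].
  rewrite -[K%:R]ger0_norm // -normrM ler_norml.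
  move: b2 b3 a2 a3; rewrite -natr1 !mulrBl !mulrDl => *.
  by apply/andP; split; lra.
exists (2 * B * K).+1, (fun u => (g (complex.Re u), g (complex.Im u))).
move=> u v /Re_Im_le[u1 u2] /Re_Im_le[v1 v2] [/(gP _ _ u1 v1) gRe /(gP _ _ u2 v2) gIm].
apply: le_lt_trans (normc_le_Re_Im _) _.
have -> : complex.Re (u - v) = complex.Re u - complex.Re v by case: (u) (v) => [? ?] [? ?].
have -> : complex.Im (u - v) = complex.Im u - complex.Im v by case: (u) (v) => [? ?] [? ?].
have : 2 / K%:R < d by rewrite ltr_pdivrMr ?ltr0n // mulrC.
apply: le_lt_trans.
rewrite -!(rmorph_nat rC) -fmorphV -rmorphM rC_le ler_pdivlMr ?ltr0n // mulrDl.
lra.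
Qed.

End Archimedean.

(** * Simultaneous approximation by values of integral polynomials *)

Section SimultaneousApproximation.
Variables (R : realType).
Local Notation C := (Cplx R).
Variables (I : finType) (x : I -> C).
Hypothesis x_norm1 : forall i, `|x i| = 1.
Hypothesis x_inj : injective x.
Hypothesis x_conj : forall i j, x i != (x j)^*.

(* For complex Lagrange polynomials L_i at the nodes and their conjugates, the
   sum of the y_i L_i and of its conjugate has real coefficients. *)
Lemma real_interpolation : exists N : nat, forall y : I -> C, exists a : {poly C},
  [/\ a \is a polyOver Num.real, (size a <= N)%N & forall i, a.[x i] = y i].
Proof.
pose Q i : {poly C} := (\prod_(j | j != i) ('X - (x j)%:P)) * \prod_j ('X - ((x j)^*)%:P).
have Qii i : (Q i).[x i] != 0.
  rewrite hornerM !horner_prod mulf_neq0 //; apply/prodf_neq0 => j ij; rewrite hornerXsubC.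
    by rewrite subr_eq0; apply: contra ij => /eqP/x_inj ->.
  by rewrite subr_eq0.
have Qij i j : j != i -> (Q i).[x j] = 0.
  by move=> ij; rewrite hornerM horner_prod (bigD1 j) //= hornerXsubC subrr !mul0r.
have Qc i j : (Q i).[(x j)^*] = 0.
  by rewrite hornerM mulrC horner_prod (bigD1 j) //= hornerXsubC subrr !mul0r.
exists (\max_i size (Q i)) => y.
pose P := \sum_i (y i / (Q i).[x i]) *: Q i.
have szP : (size P <= \max_i size (Q i))%N.
  apply: (leq_trans (size_sum _ _ _)); apply/bigmax_leqP => i _.
  exact: leq_trans (size_scale_leq _ _) (leq_bigmax i).
exists (P + map_poly Num.conj P); split.
- apply/polyOverP => k; rewrite coefD coef_map /=; apply/CrealP.
  by rewrite rmorphD /= conjCK addrC.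
- by rewrite (leq_trans (size_polyD _ _)) // geq_max szP (leq_trans (size_poly _ _)).
(* At x_i the conjugate polynomial takes the conjugate of the value of P at the conjugate of x_i,
   where every [Q j] vanishes. *)
move=> i; rewrite hornerD -{2}[x i]conjCK horner_map /= !horner_sum.
rewrite [X in _ + (X)^*]big1 => [|j _]; last by rewrite hornerZ Qc mulr0.
rewrite conjC0 addr0 (bigD1 i) //= hornerZ divfK // big1 ?addr0 // => j ji.
by rewrite hornerZ (Qij j i) ?mulr0 // eq_sym.
Qed.

(** Rounding each of the N real coefficients of an interpolating polynomial changes its value at a
    point of modulus 1 by at most 1, so D = N works. *)
Lemma integer_interpolation : exists D : nat, forall y : I -> C, exists p : {poly int},
  forall i, `|evZ p (x i) - y i| <= D%:R.
Proof.
have [N interp] := real_interpolation; exists N => y.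
have [a [/polyOverP a_real sz_a ay]] := interp y.
have [m am] := choice (fun k => Cplx_int_near (a_real k)).
exists (\poly_(k < N) m k) => i.
rewrite -ay (horner_coef_wide _ sz_a).
rewrite (@horner_coef_wide _ N); last by rewrite (leq_trans (size_poly _ _)) // size_poly.
rewrite -sumrB (le_trans (ler_norm_sum _ _ _)) //.
apply: (@le_trans _ _ (\sum_(k < N) 1)); last by rewrite sumr_const card_ord.
apply: ler_sum => k _; rewrite coef_map coef_poly ltn_ord -mulrBl normrM normrX.
by rewrite x_norm1 expr1n mulr1; exact: am.
Qed.

Lemma small_off_node (i0 : I) (d : C) : 0 < d -> exists p : {poly int},
  evZ p (x i0) != 0 /\ forall i, i != i0 -> `|evZ p (x i)| < d.
Proof.
move=> d_gt0; have [D interp] := integer_interpolation.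
have [M [f fP]] := box_cover D d_gt0.
(* The targets at [i0] are spaced by 2D + 1, more than the total error 2D of two approximations, so
   distinct indices give distinct values there. *)
have [p pP] := choice (fun N : nat =>
  interp (fun i => if i == i0 then (N * (2 * D).+1)%:R else 0)).
(* There is one more index than assignments of cells to nodes, so two indices share all cells. Only
   the nodes other than [i0], where the values stay in the disc of radius D, are exploited. *)
pose F (N : 'I_#|{ffun I -> 'I_M * 'I_M}|.+1) := [ffun i => f (evZ (p N) (x i))].
have [N [N' [neq eqF]]] : exists N N', N != N' /\ F N = F N'.
  apply: contrapT => noex; have : injective F.
    move=> N N' eqF; apply/eqP/negPn/negP => neq.
    by apply: noex; exists N, N'.
  by move/leq_card; rewrite card_ord ltnn.
exists (p N - p N'); split=> [|i ii0]; rewrite rmorphB hornerD hornerN; last first.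
  have := pP N i; have := pP N' i; rewrite (negbTE ii0) !subr0 => b' b.
  by apply: fP => //; move/ffunP/(_ i): eqF; rewrite !ffunE.
apply/negP => /eqP/subr0_eq eqp.
have := pP N i0; have := pP N' i0; rewrite eqxx eqp distrC => b' b.
have := le_trans (ler_normD _ _) (lerD b' b); rewrite addrA subrK.
have -> : (N' * (2 * D).+1)%:R - (N * (2 * D).+1)%:R =
   (N'%:Z - N%:Z)%:~R * (2 * D).+1%:R :> C.
  by rewrite rmorphB /= !natrM mulrBl.
rewrite normrM normr_nat -natrD addnn -muln2; apply/negP; rewrite lt_geF //.
have ge1 : 1 <= `|(N'%:Z - N%:Z)%:~R| :> C.
  by rewrite -intr_norm -[1]/(1%:~R) ler_int -gtz0_ge1 normr_gt0 subr_eq0 eqz_nat eq_sym.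
apply: (@lt_le_trans _ _ (2 * D).+1%:R); first by rewrite ltr_nat mulnC.
by rewrite ler_peMl.
Qed.

(** With e small off [i0], each w_i / e(x_i) is approximated within D and the result multiplied by
    e. The bound at [i0] depends on e and D, not on w. *)
Lemma simultaneous_approximation (i0 : I) (d : C) : 0 < d ->
  (forall p : {poly int}, evZ p (x i0) != 0 -> forall i, evZ p (x i) != 0) ->
  exists B : nat, forall w : I -> C, exists p : {poly int},
    `|evZ p (x i0) - w i0| < B%:R /\ forall i, i != i0 -> `|evZ p (x i) - w i| < d.
Proof.
move=> d_gt0 nz; have [D interp] := integer_interpolation.
(* Passing from D to D + 1 allows division by it and makes the error estimate strict. *)
have D1 : 0 < D.+1%:R :> C by rewrite ltr0n.
have [e [/nz e_neq0 e_small]] := small_off_node i0 (divr_gt0 d_gt0 D1).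
have [K eK] := Cplx_lt_nat (evZ e (x i0)).
exists (K * D.+1)%N => w; have [q qP] := interp (fun i => w i / evZ e (x i)).
have main i k : `|evZ e (x i)| < k -> `|evZ (e * q) (x i) - w i| < k * D.+1%:R.
  move=> ek; rewrite rmorphM hornerM.
  rewrite -(divfK (e_neq0 i) (w i)) [X in _ - X]mulrC -mulrBr normrM.
  have le1 : `|evZ q (x i) - w i / evZ e (x i)| < D.+1%:R.
    by rewrite (le_lt_trans (qP i)) // ltr_nat.
  by rewrite ltr_pM.
exists (e * q); split=> [|i ii0]; first by rewrite natrM main.
by rewrite -[d](divfK (lt0r_neq0 D1)) main ?e_small.
Qed.

End SimultaneousApproximation.

(** * Boundedness and interior of windows *)

Section Windows.
Variable R : realType.
Local Notation C := (Cplx R).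

(** Finitely many of the open discs of integer radius about 0 cover A. *)
Lemma compact_Cplx_bounded (A : set C) : compact A ->
  exists B : nat, forall x, A x -> `|x| <= B%:R.
Proof.
rewrite compact_cover => /(_ nat setT (fun m => [set x | `|x| < m%:R])) [].
- move=> m _; rewrite openE => x; rewrite /= -subr_gt0 => ltxm.
  apply/nbhs_ballP; exists (m%:R - `|x|) => // y.
  rewrite -ball_normE /= ltrBrDr distrC; apply: le_lt_trans.
  by rewrite -{1}(subrK x y) ler_normD.
- by move=> x _; have [m] := Cplx_lt_nat x; exists m.
move=> D _ cov; exists (\max_(m <- enum_fset D) m)%N => x /cov[m /= mD /ltW /le_trans].
by apply; rewrite ler_nat leq_bigmax_seq.
Qed.

Variable d : nat.
Implicit Types W : set 'rV[C]_d.

Lemma window_bounded W : W `<=` closure W° -> compact (closure W°) ->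
  exists B : nat, forall w, W w -> forall i, `|w 0 i| <= B%:R.
Proof.
move=> WK cK.
have /choice[B BP] i : exists B : nat, forall w, W w -> `|w 0 i| <= B%:R.
  have /compact_Cplx_bounded[B BP] : compact ((fun w : 'rV[C]_d => w 0 i) @` closure W°).
    apply: continuous_compact => //.
    by apply: continuous_subspaceT => w; apply: coord_continuous.
  by exists B => w /WK Kw; apply: BP; exists w.
exists (\max_i B i)%N => w Ww i; apply: le_trans (BP i w Ww) _.
by rewrite ler_nat leq_bigmax.
Qed.

Lemma window_interior W : W° !=set0 -> exists (w0 : 'rV[C]_d) (r : C),
  0 < r /\ forall w : 'rV[C]_d, (forall i, `|w 0 i - w0 0 i| < r) -> W w.
Proof.
move=> [w0 /nbhs_ballP[r /= r_gt0 sub]]; exists w0, r; split=> // w wr.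
(* A ball in the space of row vectors is a product of discs, one per coordinate. *)
by apply: sub; split=> // i j; rewrite ord1 -ball_normE /= distrC.
Qed.

End Windows.

(** * Model sets: discreteness, density and homothetic copies of finite sets *)

Section ModelSets.
Variables (R : realType) (n : nat).
Hypothesis n_gt2 : (2 < n)%N.
Local Notation C := (Cplx R).
Local Notation z := (zeta R n).
Local Notation d := (star_dim n).
Variable s : 'I_d -> C -> C.
Hypothesis star_s : star_family s.

Let n_gt0 : (0 < n)%N := ltn_trans (ltn0Sn 1) n_gt2.
Let prim_z : n.-primitive_root z := zeta_prim R n_gt0.

Let GalS i : Gal n (s i). Proof. by have [/(_ i)[]] := star_s. Qed.

(** [None] stands for physical space and [Some i] for the i-th internal coordinate, so that
    approximation treats both together. *)
Definition node (o : option 'I_d) : C := if o is Some i then s i z else z.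

Lemma node_prim_root o : n.-primitive_root (node o).
Proof. by case: o => [i|] //=; apply: Gal_prim_root. Qed.

Lemma Gal_evQ i p : s i (evQ p z) = evQ p (s i z).
Proof. exact: Gal_horner. Qed.

Lemma Gal_evZ i p : s i (evZ p z) = evZ p (s i z).
Proof. by rewrite !evZ_evQ Gal_evQ. Qed.

Lemma star_uniq i j : eq_on_Qzeta n (s j) (s i) \/ eq_on_Qzeta n (s j) (conjugate_aut (s i)) ->
  i = j.
Proof.
move=> eqj; have [/(_ i)[Gi n1 n2] /(_ _ Gi n1 n2)[k [_ uk]]] := star_s.
by rewrite -(uk i) ?(uk j) //; left.
Qed.

Lemma star_neq_zeta i : s i z != z.
Proof.
have [/(_ i)[Gi n1 _] _] := star_s; apply/eqP => eqz; apply: n1.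
by apply: eq_on_QzetaP => // p; exact: Gal_evQ.
Qed.

Lemma star_neq_conj_zeta i : s i z != z^*.
Proof.
have [/(_ i)[Gi _ n1] _] := star_s; apply/eqP => eqz; apply: n1.
by apply: eq_on_QzetaP => // p; [exact: Gal_evQ|rewrite evQ_conj].
Qed.

Lemma node_inj : injective node.
Proof.
case=> [i|] [j|] //= eqz; last 2 first.
- by have := star_neq_zeta i; rewrite eqz eqxx.
- by have := star_neq_zeta j; rewrite -eqz eqxx.
congr Some; apply: star_uniq; left.
by apply: eq_on_QzetaP => // p; exact: Gal_evQ.
Qed.

Lemma node_conj o o' : node o != (node o')^*.
Proof.
case: o o' => [i|] [j|] /=; [|exact: star_neq_conj_zeta| |exact: prim_root_nreal n_gt2 prim_z].
  (* Uniqueness in [star_family] forces i = j, and then a primitive n-th root would be real, against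
     n > 2. *)
  apply/eqP => eqz; have ij : j = i.
    apply: star_uniq; right; apply: eq_on_QzetaP => // p; first exact: Gal_evQ.
    by rewrite /conjugate_aut Gal_evQ evQ_conj.
  by have := prim_root_nreal n_gt2 (node_prim_root (Some i)); rewrite /= {1}eqz ij eqxx.
by rewrite eq_sym -(inj_eq (can_inj conjCK)) conjCK star_neq_conj_zeta.
Qed.

(** Each w is the image of zeta under an automorphism, which is the identity, conjugation, or
    represented in the star family up to conjugation. Bounds at the nodes therefore control the
    whole norm. *)
Lemma node_cover w : n.-primitive_root w -> exists o, w = node o \/ w = (node o)^*.
Proof.
move=> /Gal_exists[t [Gt <-]].
have [/eqP tz|tz] := boolP (t z == z); first by exists None; left.
have [/eqP tzc|tzc] := boolP (t z == z^*); first by exists None; right.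
have n1 : ~ eq_on_Qzeta n t id by move=> /(_ z (zeta_Qzeta _ n_gt0))/eqP; rewrite (negbTE tz).
have n2 : ~ eq_on_Qzeta n t (fun x => x^*).
  by move=> /(_ z (zeta_Qzeta _ n_gt0))/eqP; rewrite (negbTE tzc).
have [_ /(_ t Gt n1 n2)[i [eqi _]]] := star_s; exists (Some i).
case: eqi => /(_ z (zeta_Qzeta _ n_gt0)) /= ->; [by left|right].
by rewrite /conjugate_aut conjCK.
Qed.

(* The norm of a nonzero element of Z[zeta] is at least 1 in absolute value. *)
Lemma separation (B : nat) : exists2 r : R, 0 < r & forall p : {poly int},
  (forall i, `|evZ p (s i z)| <= B%:R) -> `|evZ p z| < rC r -> evZ p z = 0.
Proof.
(* K dominates the product of the factors of the norm other than the one at zeta. The base B + 1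
   also bounds the factor at the conjugate of zeta, since 1/K <= 1. *)
pose K : R := B.+1%:R ^+ totient n.
have K_ge1 : 1 <= K by rewrite exprn_ege1 // ler1n.
have K_gt0 : 0 < K by rewrite (lt_le_trans ltr01).
exists K^-1 => [|p pB pz]; first by rewrite invr_gt0.
apply/eqP/negPn/negP => /(norm_ge1 prim_z).
have zin : z \in prim_roots n z by rewrite mem_prim_roots.
rewrite (perm_big _ (perm_to_rem zin)) big_cons /=.
have pB1 o : `|evZ p (node o)| <= B.+1%:R.
  case: o => [i|] /=; first by rewrite (le_trans (pB i)) // ler_nat.
  rewrite (le_trans (ltW pz)) // -(rmorph_nat (@rC R)) rC_le.
  by rewrite (@le_trans _ _ 1) ?ler1n // invf_le1.
have prod_le (l : seq C) : {subset l <= prim_roots n z} ->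
    \prod_(x <- l) `|evZ p x| <= B.+1%:R ^+ size l.
  elim: l => [|x l IH] sub; first by rewrite big_nil.
  rewrite big_cons exprS ler_pM ?prodr_ge0 //; last first.
    by apply: IH => y yl; apply: sub; rewrite inE yl orbT.
  have : x \in prim_roots n z by rewrite sub ?mem_head.
  rewrite mem_prim_roots // => /node_cover[i [-> | ->]] //.
  by rewrite evZ_conj norm_conjC.
have {prod_le} := prod_le _ (mem_subseq (rem_subseq z (prim_roots n z))).
rewrite size_rem // size_prim_roots => prod_le /le_gtF/negP; apply.
have tot_gt0 : (0 < totient n)%N by rewrite totient_gt0.
apply: (@le_lt_trans _ _ (`|evZ p z| * rC K)).
  rewrite ler_wpM2l // (le_trans prod_le) // rmorphXn /= rmorph_nat.
  by rewrite ler_weXn2l ?ler1n // leq_pred.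
by rewrite -ltr_pdivlMr ?mul1r -?fmorphV // -(rmorph0 (@rC R)) rC_lt.
Qed.

Lemma evZ_node_nz (p : {poly int}) : evZ p (node None) != 0 -> forall o, evZ p (node o) != 0.
Proof.
move=> pz o; apply: contra pz => /eqP; rewrite !evZ_evQ => po; apply/eqP.
exact: conjugate_root (node_prim_root o) prim_z po.
Qed.

Let node_norm1 o : `|node o| = 1 := prim_root_norm1 (node_prim_root o).

Variables (W : set (internal_space R n)) (t : C).
Hypothesis Wwin : is_window W.
Let L : set C := [set x + t | x in model_set s W].

Lemma model_setP p (w0 : internal_space R n) r :
  (forall w : internal_space R n, (forall i, `|w 0 i - w0 0 i| < r) -> W w) ->
  (forall i, `|evZ p (s i z) - w0 0 i| < r) -> L (evZ p z + t).
Proof.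
move=> Wr pr; exists (evZ p z) => //; split; first by exists p.
by apply: Wr => i; rewrite mxE Gal_evZ.
Qed.

Lemma model_set_discrete : uniformly_discrete L.
Proof.
have [_ _ Wcl cW] := Wwin; have [B WB] := window_bounded Wcl cW.
(* Two points in a disc of radius r/2 differ by less than r, and the star image of their difference
   has coordinates bounded by 2B. *)
have [r r_gt0 sep] := separation (B + B).
exists (r / 2); first by rewrite divr_gt0.
move=> c _ _ [[_ [[p ->] Wp] <-] pc] [[_ [[q ->] Wq] <-] qc].
congr (_ + t); apply/eqP; rewrite -subr_eq0 -hornerN -hornerD -rmorphB.
apply/eqP/sep => [i|]; rewrite rmorphB hornerD hornerN.
  rewrite natrD (le_trans (ler_normB _ _)) // lerD //.
    by have := WB _ Wp i; rewrite mxE Gal_evZ.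
  by have := WB _ Wq i; rewrite mxE Gal_evZ.
have -> : evZ p z - evZ q z = (evZ p z + t - c) - (evZ q z + t - c) by ring.
by rewrite (le_lt_trans (ler_normB _ _)) // [r]splitr rmorphD ltrD.
Qed.

Lemma model_set_dense : relatively_dense L.
Proof.
have [W0 _ _ _] := Wwin; have [w0 [r [r_gt0 Wr]]] := window_interior W0.
have [B BP] := simultaneous_approximation node_norm1 node_inj node_conj r_gt0 evZ_node_nz.
exists B.+1%:R => [|c]; first by rewrite ltr0n.
have [p [pc pw]] := BP (fun o => if o is Some i then w0 0 i else c - t).
exists (evZ p z + t); split; last first.
  rewrite /open_disc /= -/(rC _) rmorph_nat.
  by rewrite -addrA -opprB (lt_trans pc) // ltr_nat.
by apply: (model_setP Wr) => i; have := pw (Some i) isT.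
Qed.

Lemma model_set_hom (F : set C) : finite_set F -> F `<=` Qzeta n ->
  exists lambda u, 0 < lambda /\ homothety lambda u @` F `<=` L.
Proof.
move=> /finite_seqP[l ->] Ql; have [q [M [q0 qP]]] := common_denominator n_gt0 Ql.
have [W0 _ _ _] := Wwin; have [w0 [r [r_gt0 Wr]]] := window_interior W0.
have r2 : 0 < r / 2 by rewrite divr_gt0.
have [B BP] := simultaneous_approximation node_norm1 node_inj node_conj r2 evZ_node_nz.
(* The translation brings the star image within r/2 of [w0], leaving r/2 for the rescaled copy of
   [F]. *)
have [p0 [_ p0w]] := BP (fun o => if o is Some i then w0 0 i else 0).
pose K : C := (`|q| * M)%N%:R.
have K_ge0 : 0 <= K by rewrite ler0n.
(* For E < (r/2)/k, the bound k >= r/2 gives E <= 1 and k >= K gives K E < r/2; together K E^2 <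
   r/2. *)
pose k := K + 1 + r / 2; have k_gt0 : 0 < k by rewrite addr_gt0 ?ltr_wpDl.
have dk_gt0 : 0 < r / 2 / k by rewrite divr_gt0.
have [e [e0 e_small]] := small_off_node node_norm1 node_inj node_conj None dk_gt0.
have [l0 l0_ge0 Dl0] := norm_rC (q%:~R * evZ e z).
have l0_gt0 : 0 < l0.
  by rewrite -rC_lt rmorph0 -Dl0 normr_gt0 mulf_neq0 // intr_eq0.
exists (l0 ^+ 2), (evZ p0 z + t); split; first by rewrite exprn_gt0.
move=> _ [x /qP[P [qx PM]] <-]; rewrite /homothety -/(rC _) addrA.
(* The last factor is the conjugate of e at every primitive root, so G(y) = q P(y) |e(y)|^2. *)
pose G : {poly int} := (q *: P) * e * (e \Po 'X^(n.-1)).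
have evG (y : C) : n.-primitive_root y -> evZ G y = q%:~R * evZ P y * `|evZ e y| ^+ 2.
  move=> prim_y; rewrite !rmorphM /= !hornerM linearZ hornerZ map_comp_poly /=.
  rewrite map_polyXn horner_comp hornerXn -(prim_root_conj prim_y) evZ_conj.
  by rewrite normCK !mulrA.
have -> : rC (l0 ^+ 2) * x = evZ G z.
  rewrite evG // rmorphXn /= -Dl0 normrM exprMn -qx real_normK ?realz //.
  set E := `|_|; ring.
rewrite -hornerD -rmorphD; apply: (model_setP Wr) => i.
rewrite rmorphD hornerD -addrA (le_lt_trans (ler_normD _ _)) //.
rewrite [r](splitr r) ltr_leD //; last exact/ltW/(p0w (Some i)).
have prim_i := node_prim_root (Some i).
rewrite evG // 2!normrM normrX normr_id.
have ei := e_small (Some i) isT; set E := `|evZ e _| in ei *.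
have E1 : E <= 1.
  by rewrite (le_trans (ltW ei)) // ler_pdivrMr // mul1r lerDr addr_ge0.
have KE : K * E < r / 2.
  rewrite ltr_pdivlMr // mulrC in ei; apply: le_lt_trans ei.
  by rewrite ler_wpM2r ?normr_ge0 // /k -addrA lerDl addr_ge0 // ltW.
apply: le_lt_trans KE; rewrite expr2 mulrA ler_wpM2r ?normr_ge0 // -[K]mulr1.
rewrite ler_pM ?mulr_ge0 ?normr_ge0 // /K natrM -intr_norm -abszE.
by rewrite ler_wpM2l ?ler0n // PM // (prim_root_norm1 prim_i).
Qed.

End ModelSets.

(** * The field generated by the differences *)

Section FieldOfDifferences.
Variable R : realType.
Local Notation C := (Cplx R).

Lemma gen_field_subfield (G : set C) : is_subfield (gen_field G).
Proof.
split=> [|u v|u v]; rewrite ?inE.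
- by move=> K [[K1 _ _] _]; exact: (set_mem K1).
- move=> Gu Gv K hK; have [[_ KB KV] _] := hK; apply: set_mem.
  by apply: KB; apply: mem_set; [apply: Gu|apply: Gv].
move=> Gu Gv K hK; have [[_ KB KV] _] := hK; apply: set_mem.
by apply: KV; apply: mem_set; [apply: Gu|apply: Gv].
Qed.

Lemma gen_field_least (G K : set C) : is_subfield K -> G `<=` K -> gen_field G `<=` K.
Proof. by move=> fK GK x; apply. Qed.

Lemma sub_gen_field (G : set C) : G `<=` gen_field G.
Proof. by move=> x Gx K [_]; apply. Qed.

Variable n : nat.
Hypothesis n_gt2 : (2 < n)%N.
Local Notation z := (zeta R n).

Let n_gt0 : (0 < n)%N := ltn_trans (ltn0Sn 1) n_gt2.
Let prim_z : n.-primitive_root z := zeta_prim R n_gt0.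

(** Reduction modulo X^n - 1, which vanishes at zeta, leaves degree below n; [finite_over_Q] asks
    for a spanning family, here the powers of zeta. *)
Lemma Qzeta_finite : finite_over_Q (@Qzeta R n).
Proof.
have evX k : z ^+ k = evQ 'X^k z by rewrite map_polyXn hornerXn.
exists n, (fun i => z ^+ i); split=> [i|_ /(QzetaP _ n_gt0)[p ->]].
  by apply/set_mem; rewrite evX evQ_Qzeta.
pose m : {poly rat} := 'X^n - 1.
have -> : evQ p z = evQ (p %% m) z.
  rewrite [in LHS](divp_eq p m) rmorphD rmorphM hornerD hornerM /=.
  rewrite [map_poly _ m]rmorphB /= map_polyXn rmorph1 hornerD hornerN hornerXn hornerC.
  by rewrite prim_expr_order // subrr mulr0 add0r.
exists (fun i => (p %% m)`_i).
rewrite (@horner_coef_wide _ n); first by apply: eq_bigr => i _; rewrite coef_map.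
rewrite size_map_poly -ltnS -(size_XnsubC (1 : rat) n_gt0) ltn_modp.
by rewrite -size_poly_eq0 size_XnsubC.
Qed.

(** The translation cancels in differences, and the conjugate of p(zeta) is p(zeta^(n-1)). *)
Lemma KL_sub_Qzeta (L : set C) (t : C) : L `<=` [set x + t | x in @Zzeta R n] ->
  KL L `<=` Qzeta n.
Proof.
move=> LZ; apply: gen_field_least; first exact: gen_field_subfield.
have dQ u : differences L u -> exists p : {poly int}, u = evZ p z.
  move=> [_ /LZ[_ [p ->] <-]] [_ /LZ[_ [q ->] <-]] <-; exists (p - q).
  by rewrite rmorphB hornerD hornerN; ring.
move=> _ [/dQ[p ->] | [_ /dQ[p ->] <-]]; apply/set_mem.
  by rewrite evZ_evQ evQ_Qzeta.
rewrite -evZ_conj (prim_root_conj prim_z) evZ_evQ.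
have -> : evQ (map_poly intr p) (z ^+ n.-1) = evQ (map_poly intr p \Po 'X^(n.-1)) z.
  by rewrite map_comp_poly /= map_polyXn horner_comp hornerXn.
exact: evQ_Qzeta.
Qed.

(** Zeta is the quotient of the differences h(zeta) - h(0) and h(1) - h(0), for h the homothety. *)
Lemma Qzeta_sub_KL (L : set C) (lambda : R) (t : C) : 0 < lambda ->
  homothety lambda t @` [set 0; 1; z] `<=` L -> Qzeta n `<=` KL L.
Proof.
move=> l_gt0 hL; have [_ _ KV] := @gen_field_subfield
  (differences L `|` [set u^* | u in differences L]).
have hdiff u : [set 0; 1; z] u -> lambda%:C%C * u \in mem (KL L).
  move=> zu; rewrite inE; apply: sub_gen_field; left.
  exists (homothety lambda t u); first by apply: hL; exists u.
  exists (homothety lambda t 0); first by apply: hL; exists 0 => //; left; left.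
  by rewrite /homothety mulr0 add0r addrK.
apply: gen_field_least; first exact: gen_field_subfield.
move=> _ ->; have : (lambda%:C%C * z) / (lambda%:C%C * 1) \in mem (KL L).
  by apply: KV; apply: hdiff; [right|left; right].
have l0 : (lambda%:C%C : C) != 0.
  by rewrite -/(rC _) fmorph_eq0 gt_eqF.
by rewrite mulr1 mulrAC mulfV // mul1r inE.
Qed.

End FieldOfDifferences.

Theorem proposition4p31 (R : realType) (n : nat) (hn : (3 <= n)%N)
    (L : set (Cplx R)) (hL : cyclotomic_model_set n L) :
  algebraic_Delone L.
Proof.
have [s [W [t [star_s winW DL]]]] := hL.
have LZ : L `<=` [set x + t | x in @Zzeta R n].
  by rewrite DL => _ [x [Zx _] <-]; exists x.
have hom := model_set_hom hn star_s t winW; rewrite -DL in hom.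
have KLQ : KL L = @Qzeta R n.
  apply/seteqP; split; first exact: KL_sub_Qzeta LZ.
  have [||lambda [u [l_gt0 hl]]] := hom [set 0; 1; zeta R n].
  - by rewrite !finite_setU; do ?split.
  - have [Q1 QB QV] := gen_field_subfield [set zeta R n].
    move=> _ [[->|->]|->]; apply/set_mem => //; last first.
      by rewrite zeta_Qzeta // (ltn_trans _ hn).
    have -> : (0 : Cplx R) = 1 - 1 by rewrite subrr.
    exact: QB.
  exact: Qzeta_sub_KL l_gt0 hl.
split; first split.
- by rewrite DL; apply: model_set_discrete.
- by rewrite DL; apply: model_set_dense.
- by rewrite KLQ; apply: Qzeta_finite.
by rewrite KLQ => F fF FQ; apply: hom.
Qed.
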